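(* For each bipartite digraph $B$ there are constants $c,\epsilon>0$, depending only on $B$, such that the following holds. If $G$ is a $B$-free digraph with $m$ edges, then $$\beta(G)\le \frac{m}{2}-c\,m^{3/4+\epsilon}.$$
   Context: All digraphs are finite and oriented: no loops, no parallel edges, no antiparallel edges (for distinct vertices $a,b$, at most one of $(a,b),(b,a)$ is an edge). The underlying undirected graph $\overline{B}$ of a digraph $B$ is obtained by replacing each directed edge by an undirected edge. A digraph $B$ is bipartite if $\overline{B}$ is bipartite. A digraph $G$ is $B$-free if it contains no (not necessarily induced) subgraph isomorphic to $B$ as a digraph. A digraph is acyclic if it has no directed cycles. A feedback arc set of $G=(V,E)$ is a set $S\subset E$ such that $(V,E\setminus S)$ is acyclic; $\beta(G)$ is the minimum size of a feedback arc set of $G$. *)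

(* Defs.v *)
From HB Require Import structures.
From mathcomp Require Import all_boot all_order all_algebra.
From mathcomp Require Import boolp reals exp.

Set Implicit Arguments.
Unset Strict Implicit.
Unset Printing Implicit Defensive.

(* Taking [edge] to be a relation excludes parallel edges. *)
Record digraph := Digraph {
  vertex : finType;
  edge : rel vertex;
  edge_irreflexive : irreflexive edge;
  edge_oriented : forall a b : vertex, a != b -> ~~ (edge a b && edge b a)
}.

Definition edges (G : digraph) : {set vertex G * vertex G} :=
  [set e | edge e.1 e.2].

Definition underlying (B : digraph) : rel (vertex B) :=
  fun x y => edge x y || edge y x.

Definition bipartite (B : digraph) : Prop :=
  exists side : vertex B -> bool,
    forall x y : vertex B, underlying x y -> side x != side y.

(* Only edges of [B] are required to be preserved: the copy of [B] in [G]
   need not be induced. *)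
Definition contains_copy (B G : digraph) : Prop :=
  exists f : vertex B -> vertex G,
    injective f /\ (forall x y : vertex B, edge x y -> edge (f x) (f y)).

Definition free_of (B G : digraph) : Prop := ~ contains_copy B G.

(* In MathComp the empty sequence counts as a cycle, hence [s = [::]]. *)
Definition acyclic (T : finType) (E : {set T * T}) : Prop :=
  forall s : seq T, ucycle [rel x y | (x, y) \in E] s -> s = [::].

Definition feedback_arc_set (G : digraph) (S : {set vertex G * vertex G})
    : Prop :=
  S \subset edges G /\ acyclic (edges G :\: S).

Lemma feedback_arc_set_edges (G : digraph) : feedback_arc_set (edges G).
Proof.
split=> // -[//|x s] /andP[+ _].
by rewrite setDv /= rcons_path /=; case: s => [|y s] /=; rewrite !inE ?andbF.
Qed.

(* [edges G] is the feedback arc set that makes the minimum well defined. *)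
Definition beta (G : digraph) : nat :=
  #|[arg min_(S < edges G | `[< feedback_arc_set S >]) #|S| ]|.

Lemma betaP (G : digraph) :
  (exists2 S : {set vertex G * vertex G}, feedback_arc_set S & #|S| = beta G) /\
  (forall S : {set vertex G * vertex G}, feedback_arc_set S -> beta G <= #|S|).
Proof.
rewrite /beta; case: arg_minnP => [|S /asboolP fasS minS].
  exact/asboolP/feedback_arc_set_edges.
by split=> [|S' /asboolP]; [exists S | exact: minS].
Qed.

(* Main.v *)
Require Import Defs.
From mathcomp Require Import all_boot all_order all_algebra.
From mathcomp Require Import boolp reals exp.
From mathcomp Require Import zify ring lra.

(** Write m for the number of edges of G and call m - 2 beta(G) the gain of G.
    The claim is that the gain is at least a constant times m^(3/4 + eps).

    Let A(x, y) be 1, -1 or 0 according to whether the edge goes from x to y,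
    from y to x, or is absent.  Arranging four vertex classes cyclically and
    averaging over the four ways to cut the cycle open shows that every
    bilinear sum of A(x, y) f(x) g(y), with signs or indicator functions f and
    g, is at most four times the gain ([sign_form_le], [indicator_form_le]).
    So a large value of such a form is all that is needed, and a small gain
    says that the orientation of G looks random to every pair of vertex sets.

    Two sources of large forms are available.

    First, choose f as uniformly random signs and let g(y) be the sign of the
    column sum at y.  A random signed sum of d terms has size of order sqrt(d),
    so the gain is at least of the order of the sum of sqrt(d(y)) over all y;
    [gain_ge_low_degree] records this for the vertices of degree at most
    q^2 / 2, in a form without square roots.  With q^2 slightly below the square
    root of m this beats m^(3/4) as soon as the low-degree vertices meet a
    constant fraction of the edges.

    Otherwise a constant fraction of the edges lies inside the set S of
    high-degree vertices.  There are only slightly more than sqrt(m) of them, so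
    the density of the graph induced on S is at least a negative power of m with
    a small exponent.  Its underlying graph contains many copies of the complete
    bipartite graph K_(s,s) with s = |V(B)|, hence there are many maps from B
    that send edges to underlying edges
    ([complete_bipartite_ge], [complete_bipartite_le]).  Replacing underlying
    edges by directed edges one at a time multiplies the number of these maps
    by 1/2, up to an error that is one of the bilinear forms above
    ([replace_edges]).  As G has no copy of B, only non-injective maps may
    survive, so the error, and with it the gain, has to be large
    ([bipartite_counting]); it is then almost of order m.

    The two cases are balanced in [gain_ge_power].  There m = y^(32 Q + 16) with
    Q = s^2, so that every threshold is a natural power of y, and the resulting
    gain is a constant times y^(24 Q + 13), that is m^(3/4 + 1/(32 Q + 16)). *)

Set Implicit Arguments.
Unset Strict Implicit.
Unset Printing Implicit Defensive.

Import Order.TTheory GRing.Theory Num.Theory.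

Local Open Scope ring_scope.

(** * Feedback arc sets from vertex orders *)

Lemma beta_le_rank (G : digraph) (r : vertex G -> nat) :
  (beta G <= \sum_(e in edges G) (r e.2 <= r e.1))%N.
Proof.
have -> : (\sum_(e in edges G) (r e.2 <= r e.1) =
           #|[set e in edges G | r e.2 <= r e.1]|)%N.
  rewrite -sum1_card big_mkcond [RHS]big_mkcond /=; apply: eq_bigr => e _.
  by rewrite !inE; case: edge; case: leqP.
apply: (betaP G).2; split; first by apply/subsetP=> e; rewrite inE => /andP[].
move=> [//|x s] /andP[+ _].
have sub : subrel [rel a b | (a, b) \in edges G :\:
    [set e in edges G | (r e.2 <= r e.1)%N]] (relpre r ltn).
  by move=> a b; rewrite /= !inE /= negb_and -ltnNge => /andP[/orP[/negbTE->|]].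
move=> /(sub_path sub) /(order_path_min (relpre_trans ltn_trans)).
by move=> /allP /(_ x); rewrite mem_rcons mem_head /= ltnn => /(_ isT).
Qed.

(** Edges inside a level of h cost only one half: order the levels by h, break
    the ties once by a fixed enumeration and once by its reverse, and keep the
    better of the two orders. *)
Lemma beta_le_level (G : digraph) (h : vertex G -> nat) :
  ((beta G).*2 <= \sum_(e in edges G) ((h e.2 < h e.1) + (h e.2 <= h e.1)))%N.
Proof.
pose n := #|vertex G|.
have le1 := beta_le_rank (fun x => h x * n + enum_rank x)%N.
have le2 := beta_le_rank (fun x => h x * n + rev_ord (enum_rank x))%N.
rewrite -addnn; apply: leq_trans (leq_add le1 le2) _.
rewrite -big_split /=; apply: leq_sum => -[x y] /=; rewrite inE /= => exy.
have : (enum_rank x : nat) != enum_rank y.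
  apply: contraTneq exy => /ord_inj/enum_rank_inj ->.
  by rewrite edge_irreflexive.
have := ltn_ord (enum_rank x); have := ltn_ord (enum_rank y).
rewrite -/n; move: (enum_rank x : nat) (enum_rank y : nat) => i j.
by case: (ltngtP (h y) (h x)) => [lt|gt|->] ? ? ?; nia.
Qed.

(** * The gain and its bilinear forms *)

Section Gain.
Variables (R : realFieldType) (G : digraph).
Local Notation V := (vertex G).

Definition gain : R := #|edges G|%:R - 2 * (beta G)%:R.

Definition arc_sign (x y : V) : R := (edge x y)%:R - (edge y x)%:R.

Definition degree (y : V) : R := \sum_x (underlying x y)%:R.

Definition cut_form (f g : V -> R) : R :=
  \sum_x \sum_y arc_sign x y * f x * g y.

Lemma edge_asym (x y : V) : edge x y -> edge y x = false.
Proof.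
case: (eqVneq x y) => [->|/edge_oriented]; first by rewrite edge_irreflexive.
by move=> + exy; rewrite exy => /negbTE.
Qed.

Lemma sum_edges (F : V -> V -> R) :
  \sum_(e in edges G) F e.1 e.2 = \sum_x \sum_y (edge x y)%:R * F x y.
Proof.
rewrite pair_bigA big_mkcond; apply: eq_bigr => -[x y] _.
by rewrite inE /=; case: edge; rewrite ?mul1r ?mul0r.
Qed.

Lemma cut_formE (f g : V -> R) :
  cut_form f g = \sum_(e in edges G) (f e.1 * g e.2 - f e.2 * g e.1).
Proof.
rewrite (sum_edges (fun x y => f x * g y - f y * g x)) /cut_form.
under eq_bigr do under eq_bigr do rewrite -mulrA mulrBl.
under [RHS]eq_bigr do under eq_bigr do rewrite mulrBr.
under eq_bigr do rewrite sumrB.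
under [RHS]eq_bigr do rewrite sumrB.
rewrite !sumrB; congr (_ - _).
rewrite exchange_big; apply: eq_bigr => x _; apply: eq_bigr => y _.
by [].
Qed.

(** The sign pairs (1,1), (-1,1), (-1,-1), (1,-1), with true standing for -1,
    numbered cyclically, so that consecutive pairs have determinant 2. *)
Definition quadrant (a b : bool) : nat :=
  if b then (if a then 2 else 3) else (if a then 1 else 0).

(** Among the four linear orders obtained by cutting the cyclic order of the
    quadrants open, a step to the next quadrant goes forward three times and
    backward once, while opposite quadrants are balanced.  The excess of forward
    over backward is therefore the determinant of the two sign pairs. *)
Lemma quadrant_rotations (a b c d : bool) :
  \sum_(j < 4) ((((quadrant c d + j) %% 4 < (quadrant a b + j) %% 4) +
                 ((quadrant c d + j) %% 4 <= (quadrant a b + j) %% 4))%N%:R : R)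
  = 4 - ((-1) ^+ a * (-1) ^+ d - (-1) ^+ c * (-1) ^+ b).
Proof.
by rewrite !big_ord_recl big_ord0 /=; case: a; case: b; case: c; case: d;
  rewrite /= ?expr0 ?expr1; lra.
Qed.

(** Order the vertices by quadrant, in each of the four rotations, and sum
    [beta_le_level] over them: the excesses add up to the form. *)
Lemma sign_form_le (a b : V -> bool) :
  cut_form (fun x => (-1) ^+ a x) (fun y => (-1) ^+ b y) <= 4 * gain.
Proof.
pose h (j : 'I_4) x := ((quadrant (a x) (b x) + j) %% 4)%N.
have le8 : 4 * (2 * (beta G)%:R) <= \sum_(j < 4) \sum_(e in edges G)
    ((h j e.2 < h j e.1) + (h j e.2 <= h j e.1))%N%:R :> R.
  have le j := beta_le_level (h j).
  have {}le : (4 * (beta G).*2 <= \sum_(j < 4) \sum_(e in edges G)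
      ((h j e.2 < h j e.1) + (h j e.2 <= h j e.1)))%N.
    rewrite -[X in (X * _ <= _)%N]card_ord -sum_nat_const.
    by apply: leq_sum => j _.
  move: le; rewrite -(ler_nat R) natrM -muln2 natrM natr_sum [_ * 2]mulrC.
  by under eq_bigr do rewrite natr_sum.
rewrite cut_formE /gain; move: le8; rewrite exchange_big /=.
under eq_bigr do rewrite quadrant_rotations.
rewrite sumrB sumr_const -[_ *+ _]mulr_natr; lra.
Qed.

(** Indicator functions are averages of constant and sign functions. *)
Lemma indicator_form_le (f g : V -> bool) :
  cut_form (fun x => (f x)%:R) (fun y => (g y)%:R) <= 4 * gain.
Proof.
have avg (b : bool) : b%:R = ((-1) ^+ (~~ b)%B + (-1) ^+ false%B) / 2 :> R.
  by case: b => /=; rewrite ?expr0 ?expr1; lra.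
have := sign_form_le (fun x => ~~ f x) (fun y => ~~ g y).
have := sign_form_le (fun x => ~~ f x) (fun=> false).
have := sign_form_le (fun=> false) (fun y => ~~ g y).
have := sign_form_le (fun=> false) (fun=> false).
have -> : cut_form (fun x => (f x)%:R) (fun y => (g y)%:R) =
  (cut_form (fun x => (-1) ^+ (~~ f x)%B) (fun y => (-1) ^+ (~~ g y)%B)
   + cut_form (fun x => (-1) ^+ (~~ f x)%B) (fun=> (-1) ^+ false%B)
   + cut_form (fun=> (-1) ^+ false%B) (fun y => (-1) ^+ (~~ g y)%B)
   + cut_form (fun=> (-1) ^+ false%B) (fun=> (-1) ^+ false%B)) / 4.
  rewrite /cut_form -!big_split mulr_suml; apply: eq_bigr => x _ /=.
  rewrite -!big_split mulr_suml; apply: eq_bigr => y _ /=.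
  by rewrite !avg; field.
lra.
Qed.

End Gain.

(** * Random signs *)

Section RandomSigns.
Variables (R : realFieldType) (T : finType).
Implicit Types (eps : {ffun T -> bool}) (a : T -> R) (r : seq T).

Definition flip (x : T) eps : {ffun T -> bool} :=
  [ffun z => if z == x then ~~ eps z else eps z].

Lemma flipK x : involutive (flip x).
Proof.
by move=> eps; apply/ffunP=> z; rewrite !ffunE; case: eqP; rewrite ?negbK.
Qed.

Lemma sum_sign_odd x (F : {ffun T -> bool} -> R) :
  (forall eps, F (flip x eps) = F eps) ->
  \sum_(eps : {ffun T -> bool}) (-1) ^+ eps x * F eps = 0.
Proof.
move=> evenF; set S := \sum_eps _.
have : S = - S.
  rewrite {1}/S (reindex_inj (inv_inj (@flipK x))) /= -sumrN.
  apply: eq_bigr => eps _; rewrite evenF ffunE eqxx.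
  by case: (eps x); rewrite /= ?expr0 ?expr1 ?mulN1r ?opprK ?mul1r.
lra.
Qed.

Definition sign_sum a r eps : R := \sum_(x <- r) a x * (-1) ^+ eps x.

Lemma sign_sum_flip a r x eps :
  x \notin r -> sign_sum a r (flip x eps) = sign_sum a r eps.
Proof.
move=> xr; apply: eq_big_seq => z zr; rewrite ffunE ifN //.
by apply: contraNneq xr => <-.
Qed.

Local Notation N := (#|{ffun T -> bool}|%:R : R).

(** Adding one more term to the sum leaves only the even powers of its sign
    after averaging; the bound 3 sigma^2 on the fourth moment is what makes the
    induction close. *)
Lemma sign_sum_moments a r : uniq r ->
  \sum_eps sign_sum a r eps ^+ 2 = N * \sum_(x <- r) a x ^+ 2 /\
  \sum_eps sign_sum a r eps ^+ 4 <= 3 * N * (\sum_(x <- r) a x ^+ 2) ^+ 2.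
Proof.
elim: r => [_|x r IH /= /andP[xr /IH[IH2 IH4]]].
  rewrite big_nil; split; last first.
    by rewrite big1 ?expr0n ?mulr0 // => eps _; rewrite /sign_sum big_nil expr0n.
  by rewrite big1 ?mulr0 // => eps _; rewrite /sign_sum big_nil expr0n.
rewrite big_cons; set sigma := \sum_(y <- r) _ in IH2 IH4 *.
have odd k : \sum_(eps : {ffun T -> bool}) (-1) ^+ eps x * sign_sum a r eps ^+ k
      = 0.
  by apply: sum_sign_odd => eps; rewrite sign_sum_flip.
have sg2 eps : ((-1) ^+ eps x : R) ^+ 2 = 1 by rewrite sqrr_sign.
have cst (c : R) : \sum_(eps : {ffun T -> bool}) c = c * N.
  by rewrite sumr_const mulr_natr.
have E eps : sign_sum a (x :: r) eps = a x * (-1) ^+ eps x + sign_sum a r eps.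
  by rewrite /sign_sum big_cons.
split.
  under eq_bigr => eps _.
    rewrite E (_ : _ ^+ 2 = a x ^+ 2
      + (2 * a x) * ((-1) ^+ eps x * sign_sum a r eps ^+ 1)
      + sign_sum a r eps ^+ 2); last by ring: (sg2 eps).
    over.
  by rewrite !big_split /= cst -mulr_sumr odd IH2; ring.
under eq_bigr => eps _.
  rewrite E (_ : _ ^+ 4 = a x ^+ 4
    + 4 * a x ^+ 3 * ((-1) ^+ eps x * sign_sum a r eps ^+ 1)
    + 6 * a x ^+ 2 * sign_sum a r eps ^+ 2
    + 4 * a x * ((-1) ^+ eps x * sign_sum a r eps ^+ 3)
    + sign_sum a r eps ^+ 4); last by ring: (sg2 eps).
  over.
rewrite !big_split /= cst -!mulr_sumr !odd IH2.
have : 0 <= N * a x ^+ 4 by rewrite mulr_ge0 // exprn_even_ge0.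
nra.
Qed.

(** A lower bound of Khintchine type for the first moment.  It follows from the
    second and fourth moments because 2 q^3 u >= 3 q^2 u^2 - u^4 for u >= 0,
    the difference being u (u - q)^2 (u + 2 q). *)
Lemma sum_abs_sign_sum_ge a (q : R) :
  0 < q -> 2 * \sum_x a x ^+ 2 <= q ^+ 2 ->
  3 * N * \sum_x a x ^+ 2
    <= 4 * q * \sum_(eps : {ffun T -> bool}) `|\sum_x a x * (-1) ^+ eps x|.
Proof.
move=> q0; have [] := sign_sum_moments a (index_enum_uniq T).
rewrite /sign_sum; set sigma := \sum_x a x ^+ 2.
set M2 := \sum_eps _; set M4 := \sum_eps _ => E2 le4 sq.
set M1 := \sum_eps _.
have pw : 3 * q ^+ 2 * M2 - M4 <= 2 * q ^+ 3 * M1.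
  rewrite !mulr_sumr -sumrB; apply: ler_sum => eps _.
  set S := \sum_x _.
  have -> : S ^+ 4 = `|S| ^+ 4 by rewrite -normrX ger0_norm ?exprn_even_ge0.
  have -> : S ^+ 2 = `|S| ^+ 2 by rewrite -normrX ger0_norm ?sqr_ge0.
  have : 0 <= `|S| * (`|S| - q) ^+ 2 * (`|S| + 2 * q).
    apply: mulr_ge0; first by apply: mulr_ge0; rewrite ?sqr_ge0.
    by rewrite addr_ge0 // mulr_ge0 // ltW.
  nra.
have sig0 : 0 <= sigma by apply: sumr_ge0 => x _; rewrite sqr_ge0.
have N0 : 0 <= N by rewrite ler0n.
have : 0 <= N * sigma * (q ^+ 2 - 2 * sigma) by rewrite !mulr_ge0 // subr_ge0.
move=> ge0; rewrite -(ler_pM2l (exprn_gt0 2 q0)).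
move: pw le4; rewrite E2; nra.
Qed.
End RandomSigns.

(** * Low-degree vertices *)

Section LowDegree.
Variables (R : realFieldType) (G : digraph).

Lemma arc_sign_sqr (x y : vertex G) : arc_sign R x y ^+ 2 = (underlying x y)%:R.
Proof.
rewrite /arc_sign /underlying; case exy: (edge x y).
  by rewrite (edge_asym exy) /= subr0 expr1n.
by case: edge; rewrite /= sub0r ?sqrrN ?expr1n ?expr0n.
Qed.

(** For a sign vector eps, the signs of the column sums S eps y turn the form
    into the sum of their absolute values.  The columns of degree at most
    q^2 / 2 contribute on average at least 3 d / (4 q) each. *)
Lemma gain_ge_low_degree (q : R) : 0 < q ->
  3 * \sum_(y : vertex G | 2 * degree R y <= q ^+ 2) degree R y
    <= 16 * q * gain R G.
Proof.
move=> q0; pose N : R := #|{ffun vertex G -> bool}|%:R.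
have N0 : 0 < N by rewrite ltr0n; apply/card_gt0P; exists [ffun=> true].
pose S (eps : {ffun vertex G -> bool}) y := \sum_x arc_sign R x y * (-1) ^+ eps x.
have up eps : \sum_(y | 2 * degree R y <= q ^+ 2) `|S eps y| <= 4 * gain R G.
  apply: le_trans (sign_form_le R eps (fun y => S eps y < 0)).
  rewrite /cut_form exchange_big /= big_mkcond /=; apply: ler_sum => y _.
  rewrite -mulr_suml -/(S eps y).
  have -> : S eps y * (-1) ^+ (S eps y < 0)%R = `|S eps y|.
    by case: ltrP => [lt0|ge0]; [rewrite mulrN1 ltr0_norm | rewrite mulr1 ger0_norm].
  by case: ifP.
have low y : 2 * degree R y <= q ^+ 2 ->
    3 * N * degree R y <= 4 * q * \sum_eps `|S eps y|.
  have -> : degree R y = \sum_x arc_sign R x y ^+ 2.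
    by apply: eq_bigr => x _; rewrite arc_sign_sqr.
  exact: sum_abs_sign_sum_ge.
have : 3 * N * \sum_(y : vertex G | 2 * degree R y <= q ^+ 2) degree R y
    <= 4 * q * (N * (4 * gain R G)).
  apply: (@le_trans _ _ (4 * q *
      \sum_eps \sum_(y | 2 * degree R y <= q ^+ 2) `|S eps y|)).
    rewrite [X in _ <= _ * X]exchange_big /= mulr_sumr [leRHS]mulr_sumr.
    by apply: ler_sum => y; exact: low.
  rewrite ler_pM2l ?mulr_gt0 //.
  have -> : N * (4 * gain R G) =
      \sum_(eps : {ffun vertex G -> bool}) 4 * gain R G.
    by rewrite sumr_const -[RHS]mulr_natl.
  by apply: ler_sum => eps _; exact: up.
by move=> le; rewrite -(ler_pM2l N0); lra.
Qed.

Lemma sum_degree : \sum_(y : vertex G) degree R y = 2 * #|edges G|%:R :> R.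
Proof.
have E : #|edges G|%:R = \sum_(x : vertex G) \sum_y (edge x y)%:R :> R.
  rewrite -sum1_card natr_sum (sum_edges (fun _ _ : vertex G => 1 : R)).
  by under eq_bigr do under eq_bigr do rewrite mulr1.
rewrite mulr_natl mulr2n E [X in _ = X + _]exchange_big -big_split.
apply: eq_bigr => y _.
rewrite -big_split; apply: eq_bigr => x _; rewrite /underlying.
case exy: (edge x y); first by rewrite (edge_asym exy) /= ?addr0 ?add0r.
by case: (edge y x); rewrite /= ?addr0 ?add0r.
Qed.

(** An edge that meets P is paid for by the degree of its end in P; as the
    left-hand side counts every edge twice, these degrees come with a factor
    2. *)
Lemma sum_degree_split (P : pred (vertex G)) :
  2 * #|edges G|%:R <=
  \sum_(x | ~~ P x) \sum_(y | ~~ P y) (underlying x y)%:R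
    + 2 * \sum_(y | P y) degree R y :> R.
Proof.
rewrite -sum_degree (bigID P) /=.
have : \sum_(y | ~~ P y) degree R y <=
    \sum_(x | ~~ P x) \sum_(y | ~~ P y) (underlying x y)%:R
    + \sum_(y | P y) degree R y.
  under [leLHS]eq_bigr do rewrite /degree (bigID P) /=.
  rewrite big_split /= addrC lerD //; first by rewrite exchange_big.
  rewrite exchange_big /=; apply: ler_sum => x _.
  rewrite big_mkcond; apply: ler_sum => y _.
  by rewrite /underlying [edge x y || _]orbC; case: ifP.
lra.
Qed.
End LowDegree.

(** * Averages over maps between finite sets *)

Section Maps.
Variables (R : realFieldType) (W T : finType).
Implicit Types (phi : {ffun W -> T}) (u v w : W) (x y : T).

Definition upd phi u x : {ffun W -> T} :=
  [ffun w => if w == u then x else phi w].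

Lemma updE phi u x w : upd phi u x w = if w == u then x else phi w.
Proof. exact: ffunE. Qed.

(** Exchanging the value of phi at u with x is an involution on pairs
    (phi, x). *)
Lemma sum_upd u (F : {ffun W -> T} -> R) :
  \sum_phi \sum_x F (upd phi u x) = #|T|%:R * \sum_phi F phi.
Proof.
pose swap (p : {ffun W -> T} * T) := (upd p.1 u p.2, p.1 u).
have swapK : involutive swap.
  move=> [phi x]; rewrite /swap /= updE eqxx; congr (_, _); apply/ffunP => w.
  by rewrite !updE; case: eqP => [->|].
rewrite pair_bigA (reindex_inj (inv_inj swapK)) /=.
rewrite -(pair_bigA _ (fun phi x => F (upd (upd phi u x) u (phi u)))) mulr_sumr.
apply: eq_bigr => phi _; rewrite mulr_natl -sumr_const.
under eq_bigr => x _.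
  have -> : upd (upd phi u x) u (phi u) = phi.
    by apply/ffunP => w; rewrite !updE; case: eqP => [->|].
  over.
by rewrite !sumr_const.
Qed.

(** Once the values of phi outside u and v are fixed, f depends only on phi u
    and g only on phi v, so the inner sum is a bilinear form with indicator
    functions. *)
Lemma sum_product_form_le (L : R) (A : T -> T -> R) u v
    (f g : {ffun W -> T} -> bool) : u != v ->
  (forall f' g' : T -> bool,
     \sum_x \sum_y A x y * (f' x)%:R * (g' y)%:R <= L) ->
  (forall phi y, f (upd phi v y) = f phi) ->
  (forall phi x, g (upd phi u x) = g phi) ->
  #|T|%:R ^+ 2 * \sum_(phi : {ffun W -> T}) A (phi u) (phi v) * (f phi && g phi)%:R
    <= L * #|T|%:R ^+ #|W|.
Proof.
move=> uv leL fv gu; rewrite expr2 -mulrA -(sum_upd v) -(sum_upd u).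
have -> : L * #|T|%:R ^+ #|W| = \sum_(phi : {ffun W -> T}) L.
  by rewrite sumr_const card_ffun -natrX mulr_natr.
apply: ler_sum => phi _.
apply: le_trans (leL (fun x => f (upd phi u x)) (fun y => g (upd phi v y))).
rewrite le_eqVlt; apply/orP; left; apply/eqP.
apply: eq_bigr => x _; apply: eq_bigr => y _.
have -> : g (upd phi v y) = g (upd (upd phi u x) v y).
  rewrite -(gu _ x); congr g; apply/ffunP => w; rewrite !updE.
  by case: (eqVneq w u) uv => [->|//] /negbTE ->.
by rewrite fv !updE eqxx (negbTE uv) eqxx -mulrA -natrM mulnb.
Qed.

(** Induction on n by Chebyshev's sum inequality, which comes from expanding
    the nonnegative double sum of (a_i^n - a_j^n) (a_i - a_j).  The factor #|I|
    on the left avoids the exponent n - 1. *)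
Lemma power_mean (I : finType) (a : I -> R) n : (forall i, 0 <= a i) ->
  #|I|%:R * (\sum_i a i) ^+ n <= #|I|%:R ^+ n * \sum_i a i ^+ n.
Proof.
have cst (c : R) : \sum_(i : I) c = #|I|%:R * c by rewrite sumr_const mulr_natl.
move=> a0; elim: n => [|n IH]; first by rewrite !expr0 mulr1 mul1r sumr_const.
have cheb : (\sum_i a i ^+ n) * (\sum_i a i) <= #|I|%:R * \sum_i a i ^+ n.+1.
  have : 0 <= \sum_i \sum_j (a i ^+ n - a j ^+ n) * (a i - a j).
    apply: sumr_ge0 => i _; apply: sumr_ge0 => j _.
    have [le|/ltW le] := lerP (a i) (a j).
      by rewrite mulr_le0 // subr_le0 // lerXn2r // nnegrE.
    by rewrite mulr_ge0 // subr_ge0 // lerXn2r // nnegrE.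
  have -> : \sum_i \sum_j (a i ^+ n - a j ^+ n) * (a i - a j) =
    2 * (#|I|%:R * \sum_i a i ^+ n.+1) - 2 * ((\sum_i a i ^+ n) * \sum_i a i).
    transitivity (\sum_i \sum_j ((a i ^+ n.+1 + a j ^+ n.+1)
        - (a i ^+ n * a j + a j ^+ n * a i))).
      by apply: eq_bigr => i _; apply: eq_bigr => j _; rewrite !exprS; ring.
    under eq_bigr do rewrite sumrB !big_split /= cst -mulr_sumr -mulr_suml.
    rewrite sumrB !big_split /= cst -mulr_suml -!mulr_sumr; ring.
  lra.
rewrite exprSr mulrA; apply: le_trans (ler_wpM2r _ IH) _; first exact: sumr_ge0.
by rewrite [_ ^+ n.+1]exprSr -!mulrA ler_wpM2l ?exprn_ge0.
Qed.
End Maps.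

(** * Counting maps from a bipartite digraph *)

Lemma prod_bool (R : realFieldType) (I : finType) (b : I -> bool) :
  \prod_i (b i)%:R = [forall i, b i]%:R :> R.
Proof.
case: forallP => [allb|nall]; first by rewrite big1 // => i _; rewrite allb.
have /existsP[i ni] : [exists i, ~~ b i].
  by apply: contra_notT nall; rewrite negb_exists => /forallP h i; move/negPn: (h i).
by rewrite (bigD1 i) //= (negbTE ni) mul0r.
Qed.

Section Counting.
Variables (R : realFieldType) (B H : digraph).
Local Notation W := (vertex B).
Local Notation T := (vertex H).
Local Notation k := (#|T|%:R : R).
Local Notation s := #|W|.

(** A constraint (b, (u, v)) asks for an edge from phi u to phi v, where b tells
    whether its direction is disregarded. *)
Definition respects (phi : {ffun W -> T}) (c : bool * (W * W)) : bool :=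
  (if c.1 then @underlying H else @edge H) (phi c.2.1) (phi c.2.2).

Lemma respects_upd phi w x c : c.2.1 != w -> c.2.2 != w ->
  respects (upd phi w x) c = respects phi c.
Proof. by rewrite /respects !updE => /negbTE-> /negbTE->. Qed.

Variable L : R.
Hypothesis form_le : forall f g : T -> bool,
  cut_form (fun x => (f x)%:R) (fun y => (g y)%:R) <= L.

(** No constraint of cs touches both ends of p, because B is oriented and cs
    does not contain p.  Splitting cs into the constraints that touch the head
    of p and the others gives the two factors of [sum_product_form_le]. *)
Lemma arc_sum_le (p : W * W) (cs : seq (bool * (W * W))) :
  {subset p :: map snd cs <= edges B} -> p \notin map snd cs ->
  k ^+ 2 * \sum_(phi : {ffun W -> T})
      - arc_sign R (phi p.1) (phi p.2) * (all (respects phi) cs)%:R <= L * k ^+ s.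
Proof.
case: p => u v sub uv_notin.
have euv : edge u v by have := sub (u, v) (mem_head _ _); rewrite inE.
have neq_uv : u != v by apply: contraTneq euv => ->; rewrite edge_irreflexive.
pose touches (c : bool * (W * W)) := (c.2.1 == v) || (c.2.2 == v).
pose f (phi : {ffun W -> T}) := all (respects phi) (filter (predC touches) cs).
pose g (phi : {ffun W -> T}) := all (respects phi) (filter touches cs).
have -> : \sum_(phi : {ffun W -> T})
    - arc_sign R (phi u) (phi v) * (all (respects phi) cs)%:R =
  \sum_(phi : {ffun W -> T}) - arc_sign R (phi u) (phi v) * (f phi && g phi)%:R.
  apply: eq_bigr => phi _; congr (_ * (nat_of_bool _)%:R).
  by rewrite andbC -all_cat; apply: perm_all; rewrite perm_sym (perm_filterC touches).
apply: (sum_product_form_le (A := fun x y => - arc_sign R x y)) => //.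
(* A is antisymmetric, so negating it amounts to exchanging f' and g'. *)
- move=> f' g'; apply: le_trans (form_le g' f'); rewrite le_eqVlt; apply/orP; left.
  apply/eqP; rewrite exchange_big; apply: eq_bigr => x _; apply: eq_bigr => y _.
  by rewrite /arc_sign; ring.
- move=> phi y; apply: eq_in_all => c; rewrite mem_filter /= /touches negb_or.
  by case/andP=> /andP[c1 c2] _; apply: respects_upd.
- move=> phi x; apply: eq_in_all => -[b [c1 c2]].
  rewrite mem_filter /touches /= => /andP[tc c_in].
  have c_in' : (c1, c2) \in map snd cs by apply/mapP; exists (b, (c1, c2)).
  have ec : edge c1 c2.
    by have := sub (c1, c2); rewrite in_cons c_in' orbT inE /=; apply.
  apply: respects_upd => /=.
    apply: contraTneq tc => c1u; rewrite c1u (negbTE neq_uv) /=.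
    by apply: contraNneq uv_notin => <-; rewrite -c1u.
  apply: contraTneq tc => c2u; rewrite c2u (negbTE neq_uv) orbF.
  by apply: contraTneq ec => ->; rewrite c2u (edge_asym euv).
Qed.

(** The indicator of an underlying edge is twice the indicator of a directed
    edge minus A.  Each replacement thus costs a factor 2 and an error bounded
    by [arc_sum_le]; the errors form the geometric sum 2^n - 1. *)
Lemma replace_edges (es : seq (W * W)) (cs : seq (bool * (W * W))) :
  {subset map snd cs ++ es <= edges B} -> uniq (map snd cs ++ es) ->
  k ^+ 2 * \sum_(phi : {ffun W -> T})
      (all (respects phi) (cs ++ map (pair true) es))%:R
  <= 2 ^+ size es * (k ^+ 2 * \sum_(phi : {ffun W -> T})
        (all (respects phi) (cs ++ map (pair false) es))%:R)
     + (2 ^+ size es - 1) * (L * k ^+ s).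
Proof.
elim: es cs => [|p es IH] cs sub un.
  by rewrite cats0 expr0 mul1r subrr mul0r addr0.
have un' : uniq (map snd ((true, p) :: cs) ++ es)
  by move: un; rewrite -cat1s uniq_catCA.
have sub' : {subset map snd ((true, p) :: cs) ++ es <= edges B}.
  by move=> q; rewrite /= in_cons mem_cat => hq; apply: sub;
    rewrite mem_cat in_cons orbCA.
have splitp b cs' (phi : {ffun W -> T}) : all (respects phi) (cs ++ (b, p) :: cs') =
    respects phi (b, p) && all (respects phi) (cs ++ cs').
  by rewrite !all_cat /= andbCA.
have := IH _ sub' un'.
have le_arc := @arc_sum_le p (cs ++ map (pair false) es).
have E : map snd (cs ++ map (pair false) es) = map snd cs ++ es.
  by rewrite map_cat -map_comp map_id.
rewrite E in le_arc; have {}le_arc := le_arc sub' (andP un').1.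
have step (phi : {ffun W -> T}) :
    (all (respects phi) (((true, p) :: cs) ++ map (pair false) es))%:R =
    2 * (all (respects phi) (cs ++ map (pair false) (p :: es)))%:R
    + - arc_sign R (phi p.1) (phi p.2)
      * (all (respects phi) (cs ++ map (pair false) es))%:R :> R.
  rewrite splitp cat_cons /=; case: (all _ _); rewrite ?andbF ?mulr0 ?addr0 //.
  rewrite !andbT mulr1 /respects /arc_sign /underlying /=.
  case e1: (edge (phi p.1) (phi p.2)); last by case: edge; rewrite /=; ring.
  by rewrite (edge_asym e1) /=; ring.
rewrite [X in _ <= _ * (_ * X) + _ -> _](eq_bigr _ (fun phi _ => step phi)).
rewrite big_split /= -mulr_sumr /= [2 ^+ _.+1]exprS.
under [X in _ -> _ * X <= _]eq_bigr do rewrite splitp.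
set X := \sum_phi _; set Y := \sum_phi _; set Z := \sum_phi _ in le_arc *.
set t := 2 ^+ size es => le.
have t0 : 0 <= t by rewrite exprn_ge0.
have := ler_wpM2l t0 le_arc; lra.
Qed.

Hypothesis H_gt0 : (0 < #|T|)%N.

(** For each pair u != v, the values of phi at u and v agree for a fraction 1/k
    of all maps. *)
Lemma noninjective_le :
  k * \sum_(phi : {ffun W -> T}) (~~ injectiveb phi)%:R <= s%:R ^+ 2 * k ^+ s.
Proof.
have coll (phi : {ffun W -> T}) : (~~ injectiveb phi)%:R <=
    \sum_u \sum_(v | v != u) (phi u == phi v)%:R :> R.
  case: injectiveP => [_|ninj] /=.
    by apply: sumr_ge0 => u _; apply: sumr_ge0 => v _; rewrite ler0n.
  have [u [v [uv euv]]] : exists u v, v != u /\ phi u = phi v.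
    apply: contra_notP ninj => no u v euv; apply/eqP/negPn/negP => uv.
    by apply: no; exists u, v; rewrite eq_sym.
  rewrite (bigD1 u) //= (bigD1 v) //= euv eqxx -addrA lerDl addr_ge0 //.
    by apply: sumr_ge0 => ? _; rewrite ler0n.
  by apply: sumr_ge0 => ? _; apply: sumr_ge0 => ? _; rewrite ler0n.
apply: le_trans (ler_wpM2l (ler0n _ _) (ler_sum _ (fun phi _ => coll phi))) _.
have -> : s%:R ^+ 2 * k ^+ s = \sum_(u : W) \sum_(v : W) k ^+ s.
  by rewrite !sumr_const -mulrnA -[RHS]mulr_natl natrM expr2.
rewrite exchange_big mulr_sumr; apply: ler_sum => u _.
rewrite exchange_big mulr_sumr /= big_mkcond; apply: ler_sum => v _.
case: ifPn => vu; last by rewrite exprn_ge0.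
rewrite -(sum_upd u) -natrX -card_ffun -sum1_card natr_sum.
apply: ler_sum => phi _; rewrite (bigD1 (phi v)) //= updE eqxx updE (negbTE vu) eqxx.
rewrite big1 ?addr0 // => x xv.
by rewrite !updE eqxx (negbTE vu) (negbTE xv).
Qed.

(** A dense graph has many K_(s,s): apply the power mean inequality to the
    degrees, which counts stars with s leaves, and then to the numbers of common
    neighbours of s-tuples. *)
Lemma complete_bipartite_ge :
  (\sum_(y : T) degree R y) ^+ (s ^ 2) * k ^+ s * k ^+ s <=
  k ^+ (s ^ 2) * k ^+ (s ^ 2) *
  \sum_(alpha : {ffun W -> T}) \sum_(beta : {ffun W -> T})
    [forall u, forall v, underlying (alpha u) (beta v)]%:R.
Proof.
pose c (alpha : {ffun W -> T}) y : R := \prod_u (underlying (alpha u) y)%:R.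
have c_ge0 alpha y : 0 <= c alpha y by apply: prodr_ge0 => u _; rewrite ler0n.
have deg_ge0 (y : T) : 0 <= degree R y by apply: sumr_ge0 => x _; rewrite ler0n.
have -> : \sum_(alpha : {ffun W -> T}) \sum_(beta : {ffun W -> T})
    [forall u, forall v, underlying (alpha u) (beta v)]%:R =
    \sum_alpha (\sum_y c alpha y) ^+ s.
  apply: eq_bigr => alpha _.
  rewrite -prodr_const (bigA_distr_bigA (fun=> c alpha)); apply: eq_bigr => beta _.
  rewrite -prod_bool; under eq_bigr do rewrite -prod_bool.
  by rewrite exchange_big.
have pm1 : #|{ffun W -> T}|%:R * (\sum_(alpha : {ffun W -> T}) \sum_y c alpha y) ^+ s
    <= #|{ffun W -> T}|%:R ^+ s *
       \sum_(alpha : {ffun W -> T}) (\sum_y c alpha y) ^+ s.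
  by apply: power_mean => alpha; apply: sumr_ge0.
have pm2 := power_mean s deg_ge0.
have E : \sum_(alpha : {ffun W -> T}) \sum_y c alpha y = \sum_(y : T) degree R y ^+ s.
  rewrite exchange_big; apply: eq_bigr => y _.
  by rewrite -prodr_const bigA_distr_bigA.
rewrite E in pm1; set D := \sum_(y : T) degree R y in pm2 *.
set S1 := \sum_(y : T) degree R y ^+ s in pm1 pm2; set S2 := \sum_alpha _ in pm1 *.
have {}pm1 : k ^+ s * S1 ^+ s <= k ^+ (s ^ 2) * S2.
  by move: pm1; rewrite card_ffun natrX -exprM.
have D0 : 0 <= D by apply: sumr_ge0.
have S10 : 0 <= S1 by apply: sumr_ge0 => y _; rewrite exprn_ge0.
have {}pm2 : k ^+ s * D ^+ (s ^ 2) <= k ^+ (s ^ 2) * S1 ^+ s.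
  have := lerXn2r s _ _ pm2; rewrite !nnegrE !mulr_ge0 ?exprn_ge0 // => /(_ isT isT).
  by rewrite !exprMn -!exprM.
have k_ge0 n : 0 <= k ^+ n by rewrite exprn_ge0.
by have := ler_wpM2l (k_ge0 s) pm2; have := ler_wpM2l (k_ge0 (s ^ 2)%N) pm1; lra.
Qed.

(** If all values of alpha are adjacent to all values of beta, then using alpha
    on one side of B and beta on the other maps edges to underlying edges.  The
    pair (alpha, beta) is recovered from this mixture and the opposite one, so
    every map arises k^s times. *)
Lemma complete_bipartite_le (side : W -> bool) :
  (forall u v, edge u v -> side u != side v) ->
  \sum_(alpha : {ffun W -> T}) \sum_(beta : {ffun W -> T})
    [forall u, forall v, underlying (alpha u) (beta v)]%:R <=
  k ^+ s * \sum_(phi : {ffun W -> T})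
     (all (respects phi) (map (pair true) (enum (edges B))))%:R.
Proof.
move=> bip.
pose mix (alpha beta : {ffun W -> T}) : {ffun W -> T} :=
  [ffun w => if side w then alpha w else beta w].
pose swap (p : {ffun W -> T} * {ffun W -> T}) := (mix p.1 p.2, mix p.2 p.1).
have swapK : involutive swap.
  by move=> [alpha beta]; rewrite /swap /=; congr (_, _); apply/ffunP => w;
    rewrite !ffunE; case: (side w).
have -> : k ^+ s * \sum_(phi : {ffun W -> T})
     (all (respects phi) (map (pair true) (enum (edges B))))%:R =
   \sum_(p : {ffun W -> T} * {ffun W -> T})
     (all (respects (swap p).1) (map (pair true) (enum (edges B))))%:R.
  rewrite -(reindex_inj (inv_inj swapK) (P := xpredT) (F := fun p =>
    (all (respects p.1) (map (pair true) (enum (edges B))))%:R)) /=.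
  rewrite -(pair_bigA _ (fun phi psi : {ffun W -> T} =>
    (all (respects phi) (map (pair true) (enum (edges B))))%:R)) /= mulr_sumr.
  by apply: eq_bigr => phi _; rewrite sumr_const card_ffun -natrX mulr_natl.
rewrite pair_bigA; apply: ler_sum => -[alpha beta] _ /=.
rewrite ler_nat; case: forallP => // full; rewrite lt0b; apply/allP => c.
case/mapP=> -[u v]; rewrite mem_enum inE => /= /bip uv ->.
have U x y : underlying (alpha x) (beta y) by exact: forallP (full x) y.
rewrite /respects /= !ffunE.
by case: (side u) (side v) uv => -[] //= _; rewrite // /underlying orbC; exact: U.
Qed.

(** The sum of the degrees is twice the number of edges, so for a dense H the
    left-hand side is close to k^(2 s^2 + 2) and forces L to be of order
    almost k^2. *)
Lemma bipartite_counting : bipartite B -> free_of B H ->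
  (\sum_(y : T) degree R y) ^+ (s ^ 2) * k ^+ 2 <=
  k ^+ (s ^ 2) * k ^+ (s ^ 2) * 2 ^+ #|edges B| * (s%:R ^+ 2 * k + L).
Proof.
move=> [side bip] freeB.
have k0 : 0 < k by rewrite ltr0n.
have ks0 : 0 < k ^+ s by rewrite exprn_gt0.
have := complete_bipartite_ge.
have /complete_bipartite_le : forall u v, edge u v -> side u != side v.
  by move=> u v euv; apply: bip; rewrite /underlying euv.
set X := \sum_alpha _; set N := \sum_phi _; set D := \sum_y _ => leX geX.
have := replace_edges (es := enum (edges B)) (cs := [::]).
rewrite /= -/N enum_uniq => /(_ _ isT).
have sub : {subset enum (edges B) <= edges B} by move=> e; rewrite mem_enum.
move=> /(_ sub); rewrite -cardE; set t := 2 ^+ _; set NE := \sum_phi _ => leN.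
have t1 : 0 < t by rewrite exprn_gt0.
have L0 : 0 <= L.
  apply: le_trans (form_le (fun=> false) (fun=> false)).
  by rewrite /cut_form big1 // => x _; rewrite big1 // => y _; rewrite mulr0.
have leE : k * NE <= s%:R ^+ 2 * k ^+ s.
  apply: le_trans noninjective_le; rewrite ler_wpM2l ?ler0n //.
  apply: ler_sum => phi _; rewrite ler_nat; case: allP => //= hom.
  case: injectiveP => // inj; case: freeB; exists phi; split=> // u v euv.
  by apply: (hom (false, (u, v))); apply: map_f; rewrite mem_enum inE.
have {}leN : k ^+ 2 * N <= t * (s%:R ^+ 2 * k + L) * k ^+ s.
  apply: le_trans leN _.
  have : t * k * (k * NE) <= t * k * (s%:R ^+ 2 * k ^+ s).
    by rewrite ler_wpM2l // mulr_ge0 // ltW.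
  have : 0 <= L * k ^+ s by rewrite mulr_ge0 // ltW.
  rewrite expr2; lra.
rewrite -(ler_pM2r ks0) -(ler_pM2r ks0).
have k_ge0 n : 0 <= k ^+ n by rewrite exprn_ge0 // ltW.
have := ler_wpM2r (k_ge0 2) geX.
have kQ0 := mulr_ge0 (k_ge0 (s ^ 2)%N) (k_ge0 (s ^ 2)%N).
have := ler_wpM2l (mulr_ge0 kQ0 (k_ge0 2)) leX.
have := ler_wpM2l (mulr_ge0 kQ0 (k_ge0 s)) leN.
lra.
Qed.
End Counting.

(** * Induced subgraphs *)

Section Induced.
Variables (R : realFieldType) (G : digraph) (S : {set vertex G}).

Definition induced : digraph :=
  @Digraph {x : vertex G | x \in S} (fun x y => edge (val x) (val y))
    (fun x => edge_irreflexive (val x))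
    (fun x y xy => edge_oriented xy).

Lemma free_induced (B : digraph) : free_of B G -> free_of B induced.
Proof.
move=> freeG [f [inj hom]]; apply: freeG; exists (val \o f); split=> //.
exact: inj_comp val_inj inj.
Qed.

Lemma sum_vertex_induced (F : vertex G -> R) :
  \sum_(x in S) F x = \sum_(x : vertex induced) F (val x).
Proof. exact: big_sub. Qed.

(** Extension by 0 keeps indicator functions, whereas it would not keep
    signs. *)
Lemma induced_form_le (f g : vertex induced -> bool) :
  cut_form (fun x => (f x)%:R) (fun y => (g y)%:R) <= 4 * gain R G.
Proof.
pose ext (h : vertex induced -> bool) (x : vertex G) : bool :=
  if insub x is Some u then h u else false.
have extE h u : ext h (val u) = h u by rewrite /ext valK.
have ext0 h x : x \notin S -> ext h x = false by move=> xS; rewrite /ext insubN.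
apply: le_trans (indicator_form_le R (ext f) (ext g)).
rewrite le_eqVlt; apply/orP; left; apply/eqP.
rewrite /cut_form [RHS](bigID (mem S)) /= [X in _ + X]big1 ?addr0; last first.
  by move=> x xS; rewrite big1 // => y _; rewrite ext0 // mulr0 mul0r.
rewrite sum_vertex_induced; apply: eq_bigr => x _.
rewrite [RHS](bigID (mem S)) /= [X in _ + X]big1 ?addr0; last first.
  by move=> y yS; rewrite (ext0 g) // mulr0.
by rewrite sum_vertex_induced; apply: eq_bigr => y _; rewrite !extE.
Qed.

Lemma sum_degree_induced :
  \sum_(y : vertex induced) degree R y =
  \sum_(x in S) \sum_(y in S) (underlying x y)%:R.
Proof.
rewrite exchange_big sum_vertex_induced; apply: eq_bigr => y _.
by rewrite sum_vertex_induced; apply: eq_bigr.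
Qed.

End Induced.

(** * Balancing the two cases *)

Section Balance.
Variables (R : realFieldType).

(** Covers the values of m for which the power of m is still below the constants
    of the counting argument.  The choice q = 2 m makes every vertex a
    low-degree vertex. *)
Lemma gain_ge_const (G : digraph) : (0 < #|edges G|)%N -> 3 / 16 <= gain R G.
Proof.
set m : R := #|edges G|%:R => m_gt0.
have m1 : 1 <= m by rewrite /m ler1n.
have q0 : 0 < 2 * m by lra.
have := gain_ge_low_degree G q0.
rewrite (eq_bigl xpredT) ?sum_degree -/m => [le|y].
  have : 2 * m * (3 / 16) <= 2 * m * gain R G by lra.
  by rewrite ler_pM2l.
have : degree R y <= 2 * m.
  rewrite -sum_degree (bigD1 y) //= lerDl sumr_ge0 // => z _.
  by apply: sumr_ge0 => x _; rewrite ler0n.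
have : 0 <= m * (m - 1) by rewrite mulr_ge0 // ?subr_ge0 //; lra.
by move=> mm ?; apply/idP; rewrite expr2; lra.
Qed.

(** Eliminates k from the counting inequality: k occurs with exponent at least
    2 Q on the right but only 2 on the left, so after cancelling k^2 the upper
    bound on k can be inserted on the right.  The exponent 28 Q + 20 is
    (32 Q + 16) Q - 2 (16 Q + 10) (Q - 1). *)
Lemma dense_arith (k y g C : R) (Q : nat) : 0 < k -> 1 <= y -> (0 < Q)%N ->
  0 <= g -> 1 <= C ->
  k <= 4 * y ^+ (16 * Q + 10) ->
  (y ^+ (32 * Q + 16)) ^+ Q * k ^+ 2 <= k ^+ Q * k ^+ Q * C * (Q%:R * k + 4 * g) ->
  y ^+ (28 * Q + 20) <= 16 ^+ Q * C * (4 * Q%:R * y ^+ (16 * Q + 10) + 4 * g).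
Proof.
case: Q => // Q k0 y1 _ g0 C1 lek count.
have y0 : 0 < y by lra.
set N := Q.+1%:R in count *.
have N0 : 0 <= N by rewrite ler0n.
have {}count : (y ^+ (32 * Q.+1 + 16)) ^+ Q.+1 <= k ^+ (2 * Q) * C * (N * k + 4 * g).
  rewrite -(ler_pM2r (exprn_gt0 2 k0)); apply: le_trans count _.
  rewrite le_eqVlt; apply/orP; left; apply/eqP.
  by rewrite !exprS mulnC exprM expr2; ring.
set Y := y ^+ (16 * Q.+1 + 10) in lek *.
have Y0 : 0 < Y by rewrite exprn_gt0.
have YQ0 : 0 < Y ^+ (2 * Q) by rewrite exprn_gt0.
have kQ : k ^+ (2 * Q) <= 16 ^+ Q.+1 * Y ^+ (2 * Q).
  apply: (@le_trans _ _ ((4 * Y) ^+ (2 * Q))).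
    by apply: lerXn2r => //; rewrite nnegrE ?mulr_ge0 // ltW.
  rewrite exprMn ler_wpM2r ?(ltW YQ0) // exprM.
  have -> : 4 ^+ 2 = 16 :> R by ring.
  by apply: ler_weXn2l => //; lra.
rewrite -(ler_pM2l YQ0).
have -> : Y ^+ (2 * Q) * y ^+ (28 * Q.+1 + 20) = (y ^+ (32 * Q.+1 + 16)) ^+ Q.+1.
  rewrite /Y -!exprM -exprD.
  have -> // : ((16 * Q.+1 + 10) * (2 * Q) + (28 * Q.+1 + 20)
                = (32 * Q.+1 + 16) * Q.+1)%N by clear; nia.
apply: le_trans count _.
have Nk : N * k <= N * (4 * Y) by rewrite ler_wpM2l.
have rhs0 : 0 <= N * k + 4 * g by rewrite addr_ge0 // mulr_ge0 // ltW.
apply: (@le_trans _ _ (16 ^+ Q.+1 * Y ^+ (2 * Q) * C * (N * k + 4 * g))).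
  by rewrite !ler_wpM2r //; lra.
have -> : Y ^+ (2 * Q) * (16 ^+ Q.+1 * C * (4 * N * Y + 4 * g)) =
  16 ^+ Q.+1 * Y ^+ (2 * Q) * C * (4 * N * Y + 4 * g) by ring.
have C0 : 0 <= C by lra.
rewrite ler_wpM2l ?mulr_ge0 ?(ltW YQ0) ?exprn_ge0 //; lra.
Qed.

(** If the gain were smaller, both terms on the right of the hypothesis would be
    of order y^(24 Q + 13), which bounds y by a constant; the constant lower
    bound on the gain then gives the contradiction. *)
Lemma gain_arith (y g K : R) (Q : nat) : 1 <= y -> 3 / 16 <= g -> 1 <= K ->
  y ^+ (28 * Q + 20) <= K * (4 * Q%:R * y ^+ (16 * Q + 10) + 4 * g) ->
  3 / 32 / (K * (4 * Q%:R + 4)) ^+ (24 * Q + 13) * y ^+ (24 * Q + 13) <= g.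
Proof.
move=> y1 g_ge K1 main; set Y := K * _; set n := (24 * Q + 13)%N.
have Q0 : 0 <= Q%:R :> R by rewrite ler0n.
have Y1 : 1 <= Y by apply: mulr_ege1 => //; lra.
have Yn1 : 1 <= Y ^+ n by rewrite exprn_ege1.
have Yn0 : 0 < Y ^+ n by lra.
have y0 : 0 < y by lra.
have yn0 : 0 < y ^+ n by rewrite exprn_gt0.
rewrite leNgt; apply/negP => small.
have small' : g < y ^+ n.
  apply: lt_le_trans small _; rewrite mulrAC ler_pdivrMr //.
  have : y ^+ n * 1 <= y ^+ n * Y ^+ n by rewrite ler_wpM2l // ltW.
  lra.
have leY : y <= Y.
  have e1 : (1 <= 4 * Q + 7)%N by clear; lia.
  apply: le_trans (_ : y ^+ (4 * Q + 7) <= _).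
    by have := ler_weXn2l y1 e1; rewrite expr1.
  have e2 : (28 * Q + 20 = 4 * Q + 7 + n)%N by rewrite /n; clear; lia.
  rewrite -(ler_pM2r yn0) -exprD -e2.
  apply: le_trans main _; rewrite /Y -[leRHS]mulrA ler_wpM2l //; first lra.
  have e3 : (16 * Q + 10 <= n)%N by rewrite /n; clear; lia.
  have : Q%:R * y ^+ (16 * Q + 10) <= Q%:R * y ^+ n.
    by rewrite ler_wpM2l // ler_weXn2l.
  lra.
have : 3 / 32 / Y ^+ n * y ^+ n <= 3 / 32.
  have : y ^+ n <= Y ^+ n by apply: lerXn2r; rewrite ?nnegrE //; lra.
  rewrite mulrAC ler_pdivrMr //; lra.
lra.
Qed.

(** The threshold q = y^(8 Q + 3) is y^-1 times the fourth root of m.  The set S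
    of vertices of degree above q^2 / 2 then has at most 4 m / q^2, that is
    4 y^2 sqrt(m), elements. *)
Lemma gain_ge_power (B : digraph) : bipartite B -> (0 < #|vertex B|)%N ->
  exists2 c : R, 0 < c & forall (G : digraph) (y : R),
    free_of B G -> (0 < #|edges G|)%N -> 1 <= y ->
    #|edges G|%:R = y ^+ (32 * #|vertex B| ^ 2 + 16) ->
    c * y ^+ (24 * #|vertex B| ^ 2 + 13) <= gain R G.
Proof.
move=> bipB s_gt0; set Q := (#|vertex B| ^ 2)%N.
have Q_gt0 : (0 < Q)%N by rewrite expn_gt0 s_gt0.
pose C : R := 2 ^+ #|edges B|.
have C1 : 1 <= C by rewrite exprn_ege1 // ler1n.
pose K : R := 16 ^+ Q * C.
have K1 : 1 <= K by apply: mulr_ege1; rewrite ?exprn_ege1 ?ler1n.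
have Z1 : 1 <= K * (4 * Q%:R + 4).
  apply: mulr_ege1 => //; have : 0 <= Q%:R :> R by rewrite ler0n.
  lra.
have Zn1 : 1 <= (K * (4 * Q%:R + 4)) ^+ (24 * Q + 13) by rewrite exprn_ege1.
exists (3 / 32 / (K * (4 * Q%:R + 4)) ^+ (24 * Q + 13)) => [|G y freeG m_gt0 y1 mE].
  by rewrite divr_gt0 //; lra.
have g_ge := gain_ge_const m_gt0; set g := gain R G in g_ge *.
have g0 : 0 <= g by lra.
have y0 : 0 < y by lra.
pose q := y ^+ (8 * Q + 3); have q0 : 0 < q by rewrite exprn_gt0.
have low := gain_ge_low_degree G q0; rewrite -/g in low.
pose S := [set x : vertex G | ~~ (2 * degree R x <= q ^+ 2)].
have split := sum_degree_split R (fun y : vertex G => 2 * degree R y <= q ^+ 2).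
have dense : \sum_(x : vertex G | ~~ (2 * degree R x <= q ^+ 2))
      \sum_(y : vertex G | ~~ (2 * degree R y <= q ^+ 2)) (underlying x y)%:R =
    \sum_(x : vertex (induced S)) degree R x.
  rewrite sum_degree_induced; apply: eq_big => [x|x _]; first by rewrite inE.
  by apply: eq_bigl => z; rewrite inE.
rewrite {}dense in split.
set D := \sum_(x : vertex (induced S)) _ in split.
(* Either the degrees of the low-degree vertices add up to at least m / 2, or
   the graph induced on S has at least m / 2 edges. *)
have [lowD|highD] :=
    lerP (#|edges G|%:R)
      (2 * \sum_(y : vertex G | 2 * degree R y <= q ^+ 2) degree R y).
  have e : (8 * Q + 3 + (24 * Q + 13) = 32 * Q + 16)%N by clear; lia.
  have gy : 3 / 32 * y ^+ (24 * Q + 13) <= g.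
    rewrite -(ler_pM2l q0) mulrCA /q -(exprD y (8 * Q + 3)) e -mE -/q; lra.
  apply: le_trans gy; rewrite ler_wpM2r ?exprn_ge0 ?(ltW y0) //.
  by rewrite ler_pdivrMr; lra.
have mD : #|edges G|%:R <= D by lra.
pose k : R := #|vertex (induced S)|%:R.
have k_gt0 : (0 < #|vertex (induced S)|)%N.
  rewrite lt0n; apply: contraTneq m_gt0 => /card0_eq k0.
  rewrite -leqNgt -(ler_nat R); apply: le_trans mD _.
  by rewrite /D big1 // => x; have := k0 x; rewrite inE.
have k0 : 0 < k by rewrite ltr0n.
have lek : k <= 4 * y ^+ (16 * Q + 10).
  have kq : k * q ^+ 2 <= 4 * #|edges G|%:R.
    have -> : k * q ^+ 2 = \sum_(x in S) q ^+ 2.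
      by rewrite (sum_vertex_induced S (fun=> q ^+ 2)) sumr_const -[RHS]mulr_natl.
    apply: (@le_trans _ _ (2 * \sum_(x in S) degree R x)).
      rewrite mulr_sumr; apply: ler_sum => x; rewrite inE -ltNge; exact: ltW.
    have -> : 4 * #|edges G|%:R = 2 * (2 * #|edges G|%:R) :> R by ring.
    rewrite -sum_degree ler_wpM2l // [leRHS](bigID (mem S)) /= lerDl.
    by apply: sumr_ge0 => x _; apply: sumr_ge0 => z _; rewrite ler0n.
  rewrite -(ler_pM2r (exprn_gt0 2 q0)); apply: le_trans kq _.
  have e : (16 * Q + 10 + (8 * Q + 3) * 2 = 32 * Q + 16)%N by clear; lia.
  by rewrite mE -e (exprD y (16 * Q + 10)) exprM mulrA.
have count : (y ^+ (32 * Q + 16)) ^+ Q * k ^+ 2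
    <= k ^+ Q * k ^+ Q * C * (Q%:R * k + 4 * g).
  have := bipartite_counting (@induced_form_le R G S) k_gt0 bipB
    (free_induced freeG).
  rewrite -(natrX _ #|vertex B| 2); apply: le_trans; rewrite ler_wpM2r ?exprn_ge0 //.
  rewrite -mE; apply: lerXn2r => //; rewrite nnegrE ?ler0n //.
  by apply: le_trans mD; rewrite ler0n.
exact: gain_arith (dense_arith k0 y1 Q_gt0 g0 C1 lek count).
Qed.
End Balance.

Theorem theorem1p3 (R : realType) (B : digraph) (bipB : bipartite B) :
  exists c eps : R, [/\ 0 < c, 0 < eps &
    forall G : digraph, free_of B G ->
      (beta G)%:R <=
        #|edges G|%:R / 2 - c * powR #|edges G|%:R (3 / 4 + eps)].
Proof.
have [B0|B_gt0] := posnP #|vertex B|.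
  (* The empty digraph embeds into every digraph, so no G is free of it. *)
  have noB (x : vertex B) : False by have := card0_eq B0 x; rewrite inE.
  exists 1, 1; split=> // G []; exists (fun x => False_rect _ (noB x)).
  by split=> x; case: (noB x).
have [c c_gt0 le_gain] := gain_ge_power R bipB B_gt0.
set Q := (#|vertex B| ^ 2)%N in le_gain.
pose N : R := (32 * Q + 16)%:R; have N0 : 0 < N by rewrite ltr0n addnS.
exists (c / 2), N^-1; rewrite divr_gt0 ?invr_gt0 //; split=> // G freeG.
have eps_gt0 : 0 < N^-1 by rewrite invr_gt0.
have [m0|m_gt0] := posnP #|edges G|.
  have := (betaP G).2 _ (feedback_arc_set_edges G); rewrite m0 leqn0 => /eqP ->.
  by rewrite powR0 ?mulr0 ?mul0r ?subr0 //; lra.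
set m : R := #|edges G|%:R; have m1 : 1 <= m by rewrite /m ler1n.
have m_ge0 : 0 <= m by lra.
(* Every power of m that matters is a natural power of y. *)
pose y := powR m N^-1.
have y1 : 1 <= y by rewrite -(powRr0 m) ler_powR // ltW.
have powy n : powR m (N^-1 * n%:R) = y ^+ n
  by rewrite powRrM powR_mulrn // powR_ge0.
have := le_gain G y freeG m_gt0 y1; rewrite -!powy.
have -> : N^-1 * (32 * Q + 16)%:R = 1 by rewrite mulVf // gt_eqF.
rewrite powRr1 // => /(_ erefl).
have -> : N^-1 * (24 * Q + 13)%:R = 3 / 4 + N^-1.
  apply: (mulfI (lt0r_neq0 N0)); rewrite mulVKf ?gt_eqF // mulrDr divff ?gt_eqF //.
  by rewrite /N !natrD !natrM; lra.
rewrite /gain -/m; lra.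
Qed.
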